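(* Let $G$ be a finite connected non oriented graph with $|E|\ge 1$ edges (multiple edges and loops allowed) and no vertices of degree one. For $N\ge 1$ let $\omega(N)$ be the number of covering cycles of length $N$ in $G$ and let $\Theta(N)$ be the number of equivalence classes of non periodic covering cycles of length $N$ in $G$. Then for every $N\ge 1$, $$\Theta(N)=\frac1N\sum_{g\mid N}\mu(g)\,\omega\!\left(\frac Ng\right),$$ where $\mu$ is the Möbius function. Moreover, the number of Euler cycles in $G$ is $$\frac{\Theta(|E|)}{2}=\frac{\omega(|E|)}{2|E|}.$$
   Context: Let $G=(V,E)$ be a non oriented graph. Fix an arbitrary orientation of its edges, giving oriented edges $e_1,\dots,e_{|E|}$, and add the opposite oriented edges $e_{|E|+i}=(e_i)^{-1}$, $1\le i\le |E|$, where $(e_i)^{-1}$ has as origin the end of $e_i$ and as end the origin of $e_i$ (for a loop $e_i$, $e_{|E|+i}$ is an additional oriented loop at the same vertex, distinct from $e_i$); set $(e_{|E|+i})^{-1}=e_i$. Cycle of length $N$ in $G$: an ordered sequence $(e_{i_1},\dots,e_{i_N})$ of elements of $\{e_1,\dots,e_{2|E|}\}$ such that the end of $e_{i_k}$ is the origin of $e_{i_{k+1}}$ for $1\le k<N$, the end of $e_{i_N}$ is the origin of $e_{i_1}$ (closed), $e_{i_{k+1}}\neq (e_{i_k})^{-1}$ for $1\le k<N$ (non-backtracking), and $e_{i_1}\ne (e_{i_N})^{-1}$ (tail-less). Covering cycle of $G$: a cycle in which every edge of $G$ is present at least once, i.e. for each $1\le i\le |E|$ at least one of $e_i$, $(e_i)^{-1}$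 occurs in the sequence. In $\omega(N)$, cycles are counted as sequences (circular permutations and inverses that differ as sequences are counted separately). A cycle $p$ is periodic if $p=q^r$ (the $r$-fold concatenation) for some cycle $q$ and some integer $r>1$; otherwise it is non periodic. Two cycles are equivalent if one is a circular permutation of the other. The inverse of $(e_{i_1},\dots,e_{i_N})$ is $(e_{i_N}^{-1},\dots,e_{i_1}^{-1})$; a cycle and its inverse are taken as distinct (inversion is not part of the equivalence relation). Euler cycle: a cycle that covers each edge of $G$ exactly once (for each $i$, exactly one of $e_i,(e_i)^{-1}$ occurs, and it occurs once); Euler cycles are counted up to circular permutation and inversion. *)

(* Defs.v *)
From mathcomp Require Import all_boot all_order all_algebra.
From mathcomp Require Import boolp.

Set Implicit Arguments.
Unset Strict Implicit.
Unset Printing Implicit Defensive.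

(* Distinct edges may have the same set of ends (multiple edges), and an edge
   whose set of ends is a singleton is a loop. *)
Record multigraph := Multigraph {
  vertex : finType;
  edge : finType;
  ends : edge -> {set vertex};
  ends_card : forall e, 0 < #|ends e| <= 2 }.

Arguments ends {G} e : rename.

Definition adjacent (G : multigraph) : rel (vertex G) :=
  fun u v => [exists e : edge G, ends e == [set u; v]].

Definition connected (G : multigraph) : Prop :=
  forall u v : vertex G, connect (@adjacent G) u v.

(* The second term makes a loop contribute 2. *)
Definition degree (G : multigraph) (v : vertex G) : nat :=
  #|[set e : edge G | v \in ends e]| + #|[set e : edge G | ends e == [set v]]|.

Record orientation (G : multigraph) := Orientation {
  edge_origin : edge G -> vertex G;
  edge_end : edge G -> vertex G;
  orientationP : forall e, ends e = [set edge_origin e; edge_end e] }.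

(* (e, false) is e with its chosen orientation, (e, true) is its inverse; in
   particular a loop gives two distinct oriented edges. *)
Definition oriented_edge (G : multigraph) : finType := (edge G * bool)%type.

Definition inv_edge (G : multigraph) (d : oriented_edge G) : oriented_edge G :=
  (d.1, ~~ d.2).

Section Cycles.

Variables (G : multigraph) (o : orientation G).

Definition origin_of (d : oriented_edge G) : vertex G :=
  if d.2 then edge_end o d.1 else edge_origin o d.1.

Definition end_of (d : oriented_edge G) : vertex G :=
  if d.2 then edge_origin o d.1 else edge_end o d.1.

Definition follows (d d' : oriented_edge G) : bool :=
  (end_of d == origin_of d') && (d' != inv_edge d).

(* path.cycle also relates the last item to the first one, which accounts for
   the closed and tail-less conditions. *)
Definition graph_cycle (p : seq (oriented_edge G)) : bool :=
  (0 < size p) && cycle follows p.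

Definition covering_cycle (p : seq (oriented_edge G)) : bool :=
  graph_cycle p && [forall e : edge G, ((e, false) \in p) || ((e, true) \in p)].

Definition periodic (p : seq (oriented_edge G)) : Prop :=
  exists (q : seq (oriented_edge G)) (r : nat),
    [/\ graph_cycle q, 1 < r & p = flatten (nseq r q)].

Definition omega (N : nat) : nat :=
  #|[set p : N.-tuple (oriented_edge G) | covering_cycle p]|.

Definition circular_equiv (N : nat) : rel (N.-tuple (oriented_edge G)) :=
  fun p q => [exists k : 'I_N, q == [tuple of rot k p]].

Definition Theta (N : nat) : nat :=
  #|equivalence_partition (@circular_equiv N)
      [set p : N.-tuple (oriented_edge G) |
         covering_cycle p && ~~ `[< periodic p >]]|.

Definition inv_cycle (N : nat) (p : N.-tuple (oriented_edge G)) :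
    N.-tuple (oriented_edge G) :=
  [tuple of map (@inv_edge G) (rev p)].

Definition circular_inv_equiv (N : nat) : rel (N.-tuple (oriented_edge G)) :=
  fun p q => circular_equiv p q || circular_equiv (inv_cycle p) q.

Definition euler_cycle (p : seq (oriented_edge G)) : bool :=
  graph_cycle p &&
  [forall e : edge G, count_mem (e, false) p + count_mem (e, true) p == 1].

(* Hence restricting to sequences of length #|edge G| loses no Euler cycle. *)
Lemma euler_cycle_size (p : seq (oriented_edge G)) :
  euler_cycle p -> size p = #|edge G|.
Proof.
move=> /andP[_ /forallP once].
rewrite -sum1_card -(eq_bigr _ (fun e _ => eqP (once e))) big_split /=.
elim: p {once} => [|[e b] p IHp] /=; first by rewrite !big1.
rewrite IHp !big_split /= addnACA -[LHS]add1n; congr (_ + _).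
rewrite -big_split (bigD1 e) //= big1 => [|f /negPf ne_fe].
  by rewrite !xpair_eqE eqxx; case: b.
by rewrite !xpair_eqE eq_sym ne_fe.
Qed.

Definition euler_number : nat :=
  #|equivalence_partition (@circular_inv_equiv #|edge G|)
      [set p : #|edge G|.-tuple (oriented_edge G) | euler_cycle p]|.

End Cycles.

Definition moebius (n : nat) : int :=
  if (0 < n) && all (fun p => ~~ (p ^ 2 %| n)) (primes n)
  then ((-1) ^+ size (primes n))%R else 0%R.

(* Main.v *)
Require Import Defs.
From mathcomp Require Import all_boot all_order all_algebra.
From mathcomp Require Import boolp.

(** Cycles of length [N] are words of length [N] on which the one-step rotation
acts. For a word [p], let its period [d] be the size of its orbit; then
[rot k p = p] exactly when [d %| k], and in particular [d %| N]
([rot_fixed_period], [period_dvd]).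

A word of length [N] fixed by the rotation of amount [N / g] is the [g]-th power
of its prefix of length [N / g], and the [g]-th power of a word is a covering
cycle if and only if the word is one. Hence [omega (N / g)] counts the covering
cycles of length [N] fixed by that rotation ([card_rot_fixed]), which are those
whose period divides [N / g]. Exchanging the two sums,
  [\sum_(g | N) mu g * omega (N / g) = \sum_p \sum_(g | N / d p) mu g],
where [p] runs over the covering cycles of length [N] and [d p] is its period.
The inner sum is 1 if [d p = N] and 0 otherwise ([sum_moebius]), so the total
counts the covering cycles of period [N]. These are the non periodic ones
([periodicE]), and each of their rotation classes has exactly [N] elements;
the total is therefore [N * Theta N] ([omega_moebius]).

When [N = |E|], a cycle of length [N] through every edge goes through each of
them once, so covering cycles are Euler cycles ([euler_covering]). They repeat
no oriented edge and so have period [N], which gives [omega N = N * Theta N]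
([Theta_omega]). Up to rotation and inversion their classes have [2 * N]
elements: an Euler cycle never uses both orientations of an edge, hence is not
a rotation of its inverse ([euler_inv_rotates], [omega_euler]). *)

Set Implicit Arguments.
Unset Strict Implicit.
Unset Printing Implicit Defensive.

Import GRing.Theory Num.Theory.
Local Open Scope nat_scope.

(** * Orbits and partitions into classes of equal size *)

Lemma card_equivalence_partition (T : finType) (R : rel T) (D : {set T}) n :
    {in D & &, equivalence_rel R} ->
    {in D, forall x, #|[set y in D | R x y]| = n} ->
  #|D| = #|equivalence_partition R D| * n.
Proof.
move=> eqR cardR.
apply: card_uniform_partition (equivalence_partitionP eqR) => A.
by case/imsetP=> x Dx ->; apply: cardR.
Qed.

(** The first [order f x] iterates of [x] are pairwise distinct, so only the
remainder of [k] modulo [order f x] matters, and it has to vanish. *)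
Lemma iter_fixed_order (T : finType) (f : T -> T) (x : T) k :
  injective f -> (iter k f x == x) = (order f x %| k).
Proof.
move=> injf; rewrite {1}(divn_eq k (order f x)) addnC iterD.
have -> : iter (k %/ order f x * order f x) f x = x.
  elim: (k %/ _) => //= m IHm.
  by rewrite mulSn iterD IHm iter_order.
by rewrite eq_sym -(findex_eq0 f) findex_iter ?ltn_pmod ?order_gt0.
Qed.

(** * Powers of words *)
Section Powers.
Variable T : eqType.
Implicit Types p q u v : seq T.

Definition seqpow q r := flatten (nseq r q).

Lemma size_seqpow q r : size (seqpow q r) = r * size q.
Proof. by rewrite size_flatten /shape map_nseq sumn_nseq mulnC. Qed.

Lemma seqpow_comm q r : seqpow q r ++ q = q ++ seqpow q r.
Proof. by elim: r => [|r IHr]; rewrite ?cats0 //= -catA IHr. Qed.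

(** This special case of the theorem on commuting words has a direct induction:
[v ++ u = u ++ v] forces [v] to start with [u], and the rest of [v] still
commutes with [u]. *)
Lemma commuting_seqpow u v r :
  v ++ u = u ++ v -> size v = r * size u -> v = seqpow u r.
Proof.
elim: r v => [|r IHr] v; first by move=> _ /size0nil.
rewrite mulSn => vu sz_v.
have le_uv : size u <= size v by rewrite sz_v leq_addr.
have def_v : v = u ++ drop (size u) v.
  rewrite -[LHS](cat_take_drop (size u)); congr (_ ++ _).
  by rewrite -(takel_cat u le_uv) vu take_size_cat.
set w := drop _ v in def_v.
rewrite def_v; congr (u ++ _); apply: IHr.
  rewrite -(drop_size_cat (w ++ u) (erefl (size u))) catA -def_v vu.
  by rewrite {1}def_v drop_size_cat.
by rewrite size_drop sz_v addKn.
Qed.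

Lemma rot_seqpow q r : rot (size q) (seqpow q r) = seqpow q r.
Proof. by case: r => [|r]; rewrite //= rot_size_cat seqpow_comm. Qed.

(** Writing [p] as [u ++ v] with [u] of size [m], the rotation swaps the two
factors, so invariance says that they commute. *)
Lemma rot_fixed_seqpow p m r :
  0 < r -> size p = r * m -> rot m p = p -> p = seqpow (take m p) r.
Proof.
case: r => // r _; rewrite mulSn => sz_p rot_p.
rewrite -[LHS](cat_take_drop m); congr (_ ++ _).
have sz_u : size (take m p) = m by rewrite size_takel // sz_p leq_addr.
apply: commuting_seqpow; first by rewrite cat_take_drop -[LHS]/(rot m p).
by rewrite sz_u size_drop sz_p addKn.
Qed.

Lemma take_seqpow q r : 0 < r -> take (size q) (seqpow q r) = q.
Proof. by case: r => // r _; rewrite /= take_size_cat. Qed.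

Lemma mem_seqpow q r : 0 < r -> seqpow q r =i q.
Proof.
case: r => // r _ x; rewrite /= mem_cat; case: (boolP (x \in q)) => //= xNq.
by apply: contraNF xNq => /flattenP[_ /nseqP[-> _]].
Qed.

(** A closed walk can be read as a path that starts from its own last item. All
the copies of [q] have the same last item, so the path condition for the power
is the conjunction of [r] times the same condition. *)
Lemma cycle_seqpow (e : rel T) q r : 0 < r -> cycle e (seqpow q r) = cycle e q.
Proof.
case: q => [|x q] r_gt0; first by case: r r_gt0 => // r _; elim: r.
set q' := x :: q; set z := last x q'.
have last_pow k : last z (seqpow q' k) = z.
  by elim: k => //= k IHk; rewrite last_cat IHk.
have path_pow k : path e z (seqpow q' k) = (k == 0) || path e z q'.
  elim: k => // k IHk; rewrite [LHS]cat_path -/(seqpow q' k) -[last z q']/z IHk.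
  by case: (path e z q'); rewrite ?orbT.
rewrite (cycle_path z) last_pow path_pow (cycle_path z) /=.
by case: r r_gt0.
Qed.

End Powers.

(** * Rotations of words and their periods *)
Section Rotations.
Variables (T : finType) (N : nat).
Implicit Types p q : N.-tuple T.

Definition rot1 p : N.-tuple T := [tuple of rot 1 p].

Definition period p := order rot1 p.

Lemma rot1_inj : injective rot1.
Proof. by move=> p q /(congr1 val) /rot_inj /val_inj. Qed.

Lemma val_iter_rot1 k p : k <= N -> iter k rot1 p = rot k p :> seq T.
Proof.
elim: k => [|k IHk] lt_kN /=; first by rewrite rot0.
by rewrite IHk 1?ltnW // -rotS // size_tuple.
Qed.

Lemma rot_fixed_period p k : k <= N -> (rot k p == p :> seq T) = (period p %| k).
Proof.
move=> le_kN; rewrite -(iter_fixed_order _ _ rot1_inj) -val_eqE /=.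
by rewrite val_iter_rot1.
Qed.

Lemma period_dvd p : period p %| N.
Proof. by rewrite -rot_fixed_period // -{1}(size_tuple p) rot_size. Qed.

(** Used to carry being a covering cycle, or having a given item, along a
rotation class. *)
Lemma fconnect_rot1_pred (P : pred (seq T)) p q :
    (forall k w, P (rot k w) = P w) ->
  fconnect rot1 p q -> P q = P p.
Proof.
move=> rotP pq; apply/esym.
apply: (fconnect_invariant (k := fun t : N.-tuple T => P t) _ pq) => r.
by rewrite /= rotP eqxx.
Qed.

(** A rotation of amount [d] brings item [d] to position 0, which differs from
item 0 as soon as [0 < d < N]. *)
Lemma uniq_period p : 0 < N -> uniq p -> period p = N.
Proof.
move=> N_gt0 uniq_p; apply/eqP; rewrite eqn_leq dvdn_leq ?period_dvd //=.
rewrite leqNgt; apply/negP => lt_dN; have d_gt0 := dvdn_gt0 N_gt0 (period_dvd p).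
have fix_p : rot (period p) p = p.
  by apply/eqP; rewrite rot_fixed_period // ltnW.
have x0 : T := tnth p (Ordinal N_gt0).
have : nth x0 p (period p) == nth x0 p 0.
  rewrite -[in X in _ == X]fix_p nth_cat size_drop subn_gt0 size_tuple lt_dN.
  by rewrite nth_drop addn0.
by rewrite nth_uniq ?size_tuple // gtn_eqF.
Qed.

(** The bijection is [q |-> q ^ g], whose inverse takes the prefix of length
[N / g]. *)
Lemma card_rot_fixed (P : pred (seq T)) g : 0 < N -> g %| N ->
    (forall w, P (seqpow w g) = P w) ->
  #|[set p : N.-tuple T | P p && (rot (N %/ g) p == p :> seq T)]|
  = #|[set q : (N %/ g).-tuple T | P q]|.
Proof.
move=> N_gt0 g_dv Ppow; set m := N %/ g.
have g_gt0 : 0 < g := dvdn_gt0 N_gt0 g_dv.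
have N_def : N = g * m by rewrite mulnC divnK.
have sz_pow (q : m.-tuple T) : size (seqpow q g) == N.
  by rewrite size_seqpow size_tuple -N_def.
have sz_take p : size (take m p) == m.
  by rewrite size_takel // size_tuple leq_div.
rewrite -(card_imset (f := fun q : m.-tuple T => Tuple (sz_pow q))).
  apply: eq_card => p; rewrite inE; apply/andP/imsetP => [[Pp /eqP fix_p]|].
    have def_p : tval p = seqpow (take m p) g.
      by apply: rot_fixed_seqpow; rewrite ?size_tuple.
    exists (Tuple (sz_take p)); last exact: val_inj.
    by rewrite inE /= -(Ppow (take m p)) -def_p.
  case=> q; rewrite inE => Pq -> /=; rewrite (Ppow q); split=> //.
  by rewrite -{1}(size_tuple q) rot_seqpow.
move=> q1 q2 /(congr1 val) /= eq_pow; apply/val_inj => /=.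
rewrite -(take_seqpow q1 g_gt0) -(take_seqpow q2 g_gt0) !size_tuple.
by rewrite eq_pow.
Qed.

End Rotations.

(** * The Moebius function *)

Local Open Scope ring_scope.

Lemma moebius_mul_prime p h : prime p -> (0 < h)%N ->
  moebius (p * h) = if (p %| h)%N then 0 else - moebius h.
Proof.
move=> p_pr h_gt0; have p_gt0 := prime_gt0 p_pr.
have prm_ph : perm_eq (primes (p * h)) (undup (p :: primes h)).
  apply: uniq_perm; rewrite ?primes_uniq ?undup_uniq // => q.
  by rewrite mem_undup primesM // primes_prime // !inE.
rewrite /moebius muln_gt0 p_gt0 h_gt0 /= (perm_all _ prm_ph) (perm_size prm_ph).
rewrite /= mem_primes p_pr h_gt0 /= undup_id ?primes_uniq //.
case: (boolP (p %| h)%N) => [p_h | pNh].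
  rewrite ifF //; apply/negbTE/allPn.
  exists p; last by rewrite negbK expnS dvdn_mul.
  by rewrite mem_primes p_pr h_gt0.
rewrite /= expnS dvdn_pmul2l // expn1 (negPf pNh) /= exprS mulN1r.
rewrite (eq_in_all (a2 := fun q => ~~ (q ^ 2 %| h)%N)).
  by case: ifP; rewrite ?oppr0.
move=> q; rewrite mem_primes => /and3P[q_pr _ q_h].
rewrite Gauss_dvdr // coprimeXl // prime_coprime // dvdn_prime2 //.
by apply: contraNneq pNh => <-.
Qed.

(** With [p] a prime divisor of [n = p * m], the divisors of [n] that are
multiples of [p] are the [p * h] with [h %| m]; they contribute [- moebius h]
when [p] does not divide [h], and 0 otherwise. By Gauss, the divisors of [m]
prime to [p] are those of [n] prime to [p], so everything cancels. *)
Lemma sum_moebius n : (0 < n)%N ->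
  \sum_(g <- divisors n) moebius g = (n == 1)%:R.
Proof.
move=> n_gt0; case: (ltngtP n 1%N) => [|n_gt1|->]; first by case: n n_gt0.
  set p := pdiv n; have p_pr : prime p := pdiv_prime n_gt1.
  have p_gt0 := prime_gt0 p_pr.
  have /dvdnP[m def_n] : (p %| n)%N := pdiv_dvd n.
  rewrite mulnC in def_n.
  have m_gt0 : (0 < m)%N by move: n_gt0; rewrite def_n muln_gt0 => /andP[].
  rewrite (bigID (dvdn p)) /= -[X in X + _]big_filter.
  have -> : \sum_(g <- [seq g <- divisors n | (p %| g)%N]) moebius g
          = \sum_(h <- divisors m) moebius (p * h).
    rewrite -(big_map (muln p) xpredT moebius); apply: perm_big.
    apply: uniq_perm; first by rewrite filter_uniq ?divisors_uniq.
      rewrite map_inj_uniq ?divisors_uniq // => x y /eqP.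
      by rewrite eqn_pmul2l // => /eqP.
    move=> g; rewrite mem_filter -dvdn_divisors //; apply/andP/mapP.
      case=> /dvdnP[h ->]; rewrite mulnC def_n dvdn_pmul2l // => h_m.
      by exists h; rewrite -?dvdn_divisors.
    case=> h; rewrite -dvdn_divisors // => h_m ->.
    by rewrite dvdn_mulr // def_n dvdn_pmul2l.
  rewrite [X in X + _](eq_big_seq
    (fun h => - (if ~~ (p %| h)%N then moebius h else 0))).
    rewrite sumrN -big_mkcond /= -[X in - X]big_filter -[X in _ + X]big_filter.
    rewrite (perm_big [seq g <- divisors n | ~~ (p %| g)%N]) ?addNr //=.
    apply: uniq_perm; rewrite ?filter_uniq ?divisors_uniq // => g.
    rewrite !mem_filter -!dvdn_divisors //; case: (boolP (p %| g)%N) => //= pNg.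
    by rewrite def_n Gauss_dvdr // coprime_sym prime_coprime.
  move=> h; rewrite -dvdn_divisors // => h_m.
  rewrite moebius_mul_prime ?(dvdn_gt0 m_gt0 h_m) //.
  by case: ifP; rewrite ?oppr0.
by rewrite big_seq1 /moebius /= expr0.
Qed.

(** The inversion step: the coefficient of an element [x] in the left-hand side
is the sum of [moebius] over the divisors of [N / d x]. *)
Lemma sum_moebius_fixed (T : finType) (D : {set T}) (d : T -> nat) N :
    (0 < N)%N -> {in D, forall x, d x %| N}%N ->
  \sum_(g <- divisors N) moebius g *+ #|[set x in D | (d x %| N %/ g)%N]|
  = #|[set x in D | d x == N]|%:R :> int.
Proof.
move=> N_gt0 d_dv; rewrite -sum1dep_card natr_sum big_mkcondr /=.
transitivity (\sum_(g <- divisors N) \sum_(x in D)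
                if (d x %| N %/ g)%N then moebius g else 0).
  apply: eq_bigr => g _; rewrite -big_mkcondr /= -sumr_const.
  by apply: eq_bigl => x; rewrite inE.
rewrite exchange_big /=; apply: eq_bigr => x Dx.
have /dvdnP[m def_N] := d_dv x Dx.
have := N_gt0; rewrite def_N muln_gt0 => /andP[m_gt0 dx_gt0].
rewrite -big_mkcond -big_filter /= (perm_big (divisors m)); last first.
  apply: uniq_perm; rewrite ?filter_uniq ?divisors_uniq // => g.
  rewrite mem_filter -!dvdn_divisors //.
    have [g_N|gNN] := boolP (g %| m * d x)%N; last first.
      by rewrite andbF; apply/esym/(contraNF _ gNN) => /dvdn_mulr.
    by rewrite andbT dvdn_divRL // mulnC dvdn_pmul2r.
  by rewrite -def_N.
rewrite sum_moebius // -[X in (X == _ * _)%N]mul1n eqn_pmul2r // eq_sym.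
by case: eqP.
Qed.

Local Open Scope nat_scope.

(** * Covering cycles *)

Section Graph.
Variables (G : multigraph) (o : orientation G).
Local Notation oedge := (oriented_edge G).

Lemma circular_equivE N (p q : N.-tuple oedge) :
  0 < N -> circular_equiv p q = fconnect (@rot1 _ N) p q.
Proof.
move=> N_gt0; apply/existsP/idP => [[k /eqP ->] | pq].
  suff -> : [tuple of rot k p] = iter k (@rot1 _ N) p by apply: fconnect_iter.
  by apply: val_inj; rewrite /= val_iter_rot1 // ltnW.
have lt_kN : findex (@rot1 _ N) p q < N.
  apply: leq_trans (findex_max pq) _.
  exact: dvdn_leq N_gt0 (period_dvd p).
exists (Ordinal lt_kN); apply/eqP/val_inj.
by rewrite /= -(val_iter_rot1 p (ltnW lt_kN)) (iter_findex pq).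
Qed.

Lemma circular_equivalence N (D : {set N.-tuple oedge}) :
  0 < N -> {in D & &, equivalence_rel (@circular_equiv G N)}.
Proof.
move=> N_gt0 p q r _ _ _; rewrite !circular_equivE // connect0; split=> // pq.
by rewrite (same_connect (fconnect_sym (@rot1_inj _ N)) pq).
Qed.

Lemma covering_seqpow w r :
  0 < r -> covering_cycle o (seqpow w r) = covering_cycle o w.
Proof.
move=> r_gt0; rewrite /covering_cycle /graph_cycle size_seqpow muln_gt0 r_gt0.
rewrite cycle_seqpow //; congr (_ && _).
by apply: eq_forallb => e; rewrite !mem_seqpow.
Qed.

Lemma covering_rot k w : covering_cycle o (rot k w) = covering_cycle o w.
Proof.
rewrite /covering_cycle /graph_cycle size_rot rot_cycle; congr (_ && _).
by apply: eq_forallb => e; rewrite !mem_rot.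
Qed.

(** A proper root [q] of [p] gives an invariant rotation of amount
[size q < N], which excludes period [N]. Conversely a period [d < N] exhibits
[p] as a power of its prefix of length [d], itself a cycle. *)
Lemma periodicE N (p : N.-tuple oedge) :
  0 < N -> graph_cycle o p -> periodic o p <-> period p != N.
Proof.
move=> N_gt0 cyc_p; split=> [[q [r [cyc_q r_gt1 def_p]]] | d_neqN].
  have q_gt0 : 0 < size q by case/andP: cyc_q.
  have lt_qN : size q < N.
    by rewrite -(size_tuple p) def_p size_seqpow ltn_Pmull.
  have : period p %| size q.
    by rewrite -(rot_fixed_period _ (ltnW lt_qN)) def_p rot_seqpow.
  by move/(dvdn_leq q_gt0); apply: contraTneq => ->; rewrite -ltnNge.
have d_dv := period_dvd p; set d := period p in d_neqN d_dv.
have [le_dN r_gt0] : d <= N /\ 0 < N %/ d.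
  by have le_dN := dvdn_leq N_gt0 d_dv; rewrite divn_gt0 // (dvdn_gt0 N_gt0).
have fix_p : rot d p = p by apply/eqP; rewrite rot_fixed_period.
have def_p : p = seqpow (take d p) (N %/ d) :> seq _.
  by apply: rot_fixed_seqpow; rewrite // size_tuple divnK.
exists (take d p), (N %/ d); split=> //.
  move: cyc_p; rewrite /graph_cycle {1 2}def_p cycle_seqpow // size_seqpow.
  by rewrite muln_gt0 r_gt0.
rewrite ltn_neqAle r_gt0 andbT; apply: contra d_neqN => /eqP r1.
by rewrite -(divnK d_dv) -r1 mul1n.
Qed.

Definition primitive_covering N :=
  [set p : N.-tuple oedge | covering_cycle o p && (period p == N)].

Lemma nonperiodic_covering N : 0 < N ->
  [set p : N.-tuple oedge | covering_cycle o p && ~~ `[< periodic o p >]]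
  = primitive_covering N.
Proof.
move=> N_gt0; apply/setP => p; rewrite !inE; apply: andb_id2l => /andP[cyc_p _].
have perE := periodicE N_gt0 cyc_p.
by apply/asboolPn/idP => [/perE/negP|]; rewrite ?negbK // => /eqP d_N /perE/eqP.
Qed.

(** The rotation class of a word has as many elements as its period, here
[N]. *)
Lemma card_primitive_covering N :
  0 < N -> #|primitive_covering N| = Theta o N * N.
Proof.
move=> N_gt0; rewrite /Theta nonperiodic_covering //.
apply: card_equivalence_partition; first exact: circular_equivalence.
move=> p; rewrite inE => /andP[cov_p /eqP d_N]; rewrite -[RHS]d_N.
apply: eq_card => q; rewrite !inE circular_equivE //.
apply/andb_idl => pq.
rewrite (fconnect_rot1_pred covering_rot pq) cov_p -[X in _ == X]d_N.
apply/eqP/eq_card => r.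
by rewrite !inE (same_connect (fconnect_sym (@rot1_inj _ N)) pq).
Qed.

(** Here the bijection of [card_rot_fixed] turns [omega o (N %/ g)] into the
number of covering cycles of length [N] whose period divides [N %/ g]. *)
Lemma omega_moebius N : 0 < N ->
  (\sum_(g <- divisors N) moebius g *+ omega o (N %/ g)
   = (Theta o N * N)%:R :> int)%R.
Proof.
move=> N_gt0; rewrite -card_primitive_covering //.
pose D := [set p : N.-tuple oedge | covering_cycle o p].
have -> : primitive_covering N = [set p in D | period p == N].
  by apply/setP => p; rewrite !inE.
rewrite -(sum_moebius_fixed N_gt0 (fun p _ => period_dvd p)).
apply: eq_big_seq => g; rewrite -dvdn_divisors // => g_dv; congr (_ *+ _)%R.
have covP w := covering_seqpow w (dvdn_gt0 N_gt0 g_dv).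
rewrite /omega -(card_rot_fixed N_gt0 g_dv covP).
by apply: eq_card => p; rewrite !inE rot_fixed_period // leq_div.
Qed.

End Graph.

(** * Euler cycles *)
Section Euler.
Variables (G : multigraph) (o : orientation G).
Hypothesis E_gt0 : 0 < #|edge G|.
Local Notation oedge := (oriented_edge G).
Local Notation N := #|edge G|.
Local Notation rotates := (fconnect (@rot1 oedge N)).
Implicit Types p q r : N.-tuple oedge.

Lemma count_edge (e : edge G) (w : seq oedge) :
  count_mem (e, false) w + count_mem (e, true) w = count_mem e (map fst w).
Proof.
elim: w => //= [[f b] w] <-; rewrite addnACA !xpair_eqE /=.
by congr (_ + _); case: (f == e); case: b.
Qed.

Lemma euler_cycleE (w : seq oedge) :
  euler_cycle o w =
  graph_cycle o w && [forall e, count_mem e (map fst w) == 1].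
Proof.
by congr (_ && _); apply: eq_forallb => e; rewrite count_edge.
Qed.

(** The list of edges underlying a covering cycle of length [|E|] contains all
the [|E|] edges, so it has no room for repetitions. *)
Lemma euler_covering p : covering_cycle o p = euler_cycle o p.
Proof.
rewrite euler_cycleE; congr (_ && _); apply/forallP/forallP => [cov e | once e].
  have all_in f : f \in map fst p.
    by case/orP: (cov f) => /(map_f fst).
  have uniq_p : uniq (map fst p).
    apply: (leq_size_uniq (enum_uniq (edge G))) => [f _|]; first exact: all_in.
    by rewrite size_map size_tuple -cardE.
  by rewrite count_uniq_mem // all_in.
rewrite -!has_pred1 !has_count -addn_gt0 count_edge.
by rewrite (eqP (once e)).
Qed.

Lemma euler_uniq (w : seq oedge) : euler_cycle o w -> uniq w.
Proof.
rewrite euler_cycleE => /andP[_ /forallP once]; apply: (@map_uniq _ _ fst).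
apply: count_mem_uniq => e.
by rewrite (eqP (once e)) -has_pred1 has_count (eqP (once e)).
Qed.

Lemma euler_period p : euler_cycle o p -> period p = N.
Proof. by move/euler_uniq; apply: uniq_period. Qed.

Lemma inv_edgeK : involutive (@inv_edge G).
Proof. by case=> e b; rewrite /inv_edge negbK. Qed.

Lemma follows_inv d d' : follows o (inv_edge d') (inv_edge d) = follows o d d'.
Proof.
have end_inv : end_of o (inv_edge d') = origin_of o d' by case: d' => ? [].
have origin_inv : origin_of o (inv_edge d) = end_of o d by case: d => ? [].
rewrite /follows inv_edgeK end_inv origin_inv.
by congr (_ && ~~ _); apply: eq_sym.
Qed.

Lemma inv_cycleK : involutive (@inv_cycle G N).
Proof.
by move=> p; apply: val_inj; rewrite /= -map_rev revK mapK //; apply: inv_edgeK.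
Qed.

Lemma euler_inv p : euler_cycle o (inv_cycle p) = euler_cycle o p.
Proof.
rewrite !euler_cycleE; congr (_ && _); last first.
  by apply: eq_forallb => e; rewrite -map_comp /= map_rev count_rev.
rewrite /graph_cycle size_map size_rev cycle_map rev_cycle; congr (_ && _).
by apply: eq_cycle => d d'; apply: follows_inv.
Qed.

(** Rotations have the same items, so if [p] were a rotation of its inverse it
would use both orientations of its first edge. *)
Lemma euler_inv_rotates p : euler_cycle o p -> ~~ rotates p (inv_cycle p).
Proof.
rewrite /euler_cycle => /andP[_ /forallP once]; apply/negP => rot_p.
pose d := tnth p (Ordinal E_gt0); have p_d : d \in tval p by apply: mem_tnth.
have p_d' : inv_edge d \in tval p.
  rewrite -(fconnect_rot1_pred (P := fun w => inv_edge d \in w) _ rot_p) => [|k w].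
    by rewrite map_f // mem_rev.
  by rewrite mem_rot.
have := once d.1; rewrite eqn_leq => /andP[le1 _].
have : 1 < count_mem (d.1, false) p + count_mem (d.1, true) p.
  rewrite -[2]/(1 + 1) leq_add // -has_count has_pred1.
    by case: (d) p_d p_d' => e [].
  by case: (d) p_d p_d' => e [].
by rewrite ltnNge le1.
Qed.

(** Inversion turns rotations into rotations in the opposite direction. *)
Lemma rotates_inv p q : rotates p q -> rotates (inv_cycle p) (inv_cycle q).
Proof.
have symr := fconnect_sym (@rot1_inj oedge N).
have inv1 r : rotates (inv_cycle (rot1 r)) (inv_cycle r).
  suff <- : rot1 (inv_cycle (rot1 r)) = inv_cycle r by apply: fconnect1.
  by apply: val_inj; rewrite /= rev_rot map_rotr rotrK.
pose k t := rotates (inv_cycle p) (inv_cycle t).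
move=> pq; rewrite -[rotates _ _]/(k q) -(fconnect_invariant (k := k) _ pq).
  exact: connect0.
by move=> r; rewrite /= /k (same_connect_r symr (inv1 r)) eqxx.
Qed.

Lemma circular_inv_equivalence (D : {set N.-tuple oedge}) :
  {in D & &, equivalence_rel (@circular_inv_equiv G N)}.
Proof.
have symr := fconnect_sym (@rot1_inj oedge N).
move=> p q r _ _ _; rewrite /circular_inv_equiv !circular_equivE // connect0.
split=> // /orP[pq | p'q].
  by rewrite (same_connect symr pq) (same_connect symr (rotates_inv pq)).
have := rotates_inv p'q; rewrite inv_cycleK => pq'.
by rewrite (same_connect symr pq') (same_connect symr p'q) orbC.
Qed.

(** The class of an Euler cycle is the disjoint union of its rotations and of
the rotations of its inverse, [N] of each. *)
Lemma omega_euler : omega o N = euler_number o * (2 * N).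
Proof.
rewrite /euler_number -(card_equivalence_partition (n := 2 * N)).
- by apply: eq_card => p; rewrite !inE euler_covering.
- exact: circular_inv_equivalence.
move=> p; rewrite inE => eul_p.
have rot_euler q r : rotates q r -> euler_cycle o q -> euler_cycle o r.
  rewrite -!euler_covering => qr.
  by rewrite (fconnect_rot1_pred (covering_rot o) qr).
pose orb q := [set r | rotates q r].
have card_orb q : euler_cycle o q -> #|orb q| = N.
  move=> eul_q; rewrite -[RHS](euler_period eul_q).
  by apply: eq_card => r; rewrite !inE.
have eul_p' : euler_cycle o (inv_cycle p) by rewrite euler_inv.
transitivity #|orb p :|: orb (inv_cycle p)|.
  apply: eq_card => q; rewrite !inE /circular_inv_equiv !circular_equivE //.
  by apply/andb_idl => /orP[] /rot_euler ->.
rewrite cardsU !card_orb // disjoint_setI0 ?cards0 ?subn0 ?mul2n ?addnn //.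
apply/pred0P => q; rewrite /= !inE.
apply/negP => /andP[pq]; rewrite fconnect_sym; last exact: rot1_inj.
by move/(connect_trans pq); apply/negP/euler_inv_rotates.
Qed.

Lemma Theta_omega : omega o N = Theta o N * N.
Proof.
rewrite -card_primitive_covering //; apply: eq_card => p; rewrite !inE.
by apply/esym/andb_idr; rewrite euler_covering => /euler_period ->.
Qed.

End Euler.

Local Open Scope ring_scope.

Theorem theorem2p2 (G : multigraph) (o : orientation G)
  (G_connected : connected G) (E_gt0 : (0 < #|edge G|)%N)
  (no_deg1 : forall v : vertex G, degree v <> 1%N) :
  (forall N : nat, (0 < N)%N ->
     (Theta o N)%:R =
       N%:R^-1 * \sum_(g <- divisors N)
                   (moebius g)%:~R * (omega o (N %/ g)%N)%:R :> rat)
  /\ (euler_number o)%:R = (Theta o #|edge G|)%:R / 2%:R :> rat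
  /\ (Theta o #|edge G|)%:R / 2%:R =
       (omega o #|edge G|)%:R / (2%:R * #|edge G|%:R) :> rat.
Proof.
have natQ_neq0 n : (0 < n)%N -> n%:R != 0 :> rat by rewrite pnatr_eq0 lt0n.
split=> [N N_gt0|].
  under eq_bigr do rewrite mulr_natr -rmorphMn.
  by rewrite -rmorph_sum omega_moebius // rmorph_nat natrM mulrC mulfK ?natQ_neq0.
have E_neq0 := natQ_neq0 _ E_gt0.
have Theta_euler : Theta o #|edge G| = (euler_number o * 2)%N.
  apply/eqP; rewrite -(eqn_pmul2r E_gt0) -Theta_omega // -mulnA.
  by rewrite -omega_euler.
split; first by rewrite Theta_euler natrM mulfK.
by rewrite Theta_omega // natrM -mulf_div divff ?mulr1.
Qed.
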